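(* Let $\mathbb{F}$ be an algebraically closed field of characteristic $\neq 2$ and let $\bigwedge$ be the exterior algebra of order $6$ over $\mathbb{F}$ in the indeterminates $x_1,\ldots,x_6$, with set of monomials $M_{\bigwedge}$. Then there exist a noncoherent term order $\prec$ on $M_{\bigwedge}$ and a homogeneous ideal $I\subset\bigwedge$ such that $in_{\prec}(I)$ is a noncoherent initial ideal; that is, $in_{\prec}(I)\neq in_{\prec_c}(I)$ for every coherent term order $\prec_c$ on $M_{\bigwedge}$.
   Context: The exterior algebra $\bigwedge$ of order $n$ over $\mathbb{F}$ consists of polynomials with coefficients in $\mathbb{F}$ in noncommuting indeterminates $x_1,\ldots,x_n$ subject to $x_ix_j=-x_jx_i$ for $1\le i,j\le n$ (so $x_i^2=0$). For $\mathbf{a}=(a^{(1)},\ldots,a^{(n)})\in\{0,1\}^n$, $\mathbf{x}^{\mathbf{a}}$ denotes $x_1^{a^{(1)}}\cdots x_n^{a^{(n)}}$ (factors in increasing order of index), and $M_{\bigwedge}=\{\mathbf{x}^{\mathbf{a}}:\mathbf{a}\in\{0,1\}^n\}$ is the set of monomials, an $\mathbb{F}$-basis of $\bigwedge$. A term order $\prec$ on $M_{\bigwedge}$ is a (strict) total order on $M_{\bigwedge}$ such that (i) $1=\mathbf{x}^{\mathbf{0}}\prec\mathbf{x}^{\mathbf{a}}$ for all $\mathbf{x}^{\mathbf{a}}\neq 1$ in $M_{\bigwedge}$; (ii) if $\mathbf{x}^{\mathbf{a}}\prec\mathbf{x}^{\mathbf{b}}$ then $\mathbf{x}^{\mathbf{a}+\mathbf{c}}\prec\mathbf{x}^{\mathbf{b}+\mathbf{c}}$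 whenever $\mathbf{x}^{\mathbf{a}+\mathbf{c}}$ and $\mathbf{x}^{\mathbf{b}+\mathbf{c}}$ are both in $M_{\bigwedge}$ (with $\mathbf{c}\in\mathbb{N}^n$). A term order $\prec$ is coherent if there exists $w\in\mathbb{R}^n$ such that $w\cdot\mathbf{a}<w\cdot\mathbf{b}$ whenever $\mathbf{x}^{\mathbf{a}}\prec\mathbf{x}^{\mathbf{b}}$, and noncoherent otherwise. For nonzero $f=\sum_i c_i\mathbf{x}^{\mathbf{a}_i}\in\bigwedge$ with $0\ne c_i\in\mathbb{F}$ and distinct $\mathbf{x}^{\mathbf{a}_i}\in M_{\bigwedge}$, the initial monomial $in_{\prec}(f)$ is the $\prec$-largest of the $\mathbf{x}^{\mathbf{a}_i}$. For a left ideal $I\subseteq\bigwedge$, the initial ideal $in_{\prec}(I)$ is the monomial ideal left-generated by $\{in_{\prec}(f): 0\ne f\in I\}$. Homogeneous left ideals of $\bigwedge$ are two-sided. An initial ideal $in_{\prec}(I)$ with respect to a noncoherent term order $\prec$ is called a noncoherent initial ideal if $in_{\prec}(I)\neq in_{\prec_c}(I)$ for every coherent term order $\prec_c$. *)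

(* Defs.v *)
From HB Require Import structures.
From mathcomp Require Import all_boot all_order all_algebra.
From mathcomp Require Import classical_sets reals.

Set Implicit Arguments.
Unset Strict Implicit.
Unset Printing Implicit Defensive.

Import Order.TTheory GRing.Theory Num.Theory.

(* The monomial x^a is represented by its exponent vector a in {0,1}^n;       *)
(* exponents are read as naturals through the coercion from bool to nat.      *)
Notation mono n := {ffun 'I_n -> bool}.

Section Exponents.
Variable n : nat.
Implicit Types a b c d e : mono n.

Definition mono0 : mono n := [ffun => false].

Definition mono_var (i : 'I_n) : mono n := [ffun j => j == i].

Definition mdeg a : nat := (\sum_(i < n) a i)%N.

(* The addition of exponents is partial on {0,1}^n, hence a relation. *)
Definition mono_sum a b c : bool := [forall i, c i == a i + b i :> nat].

(* Number of transpositions that sort x^a x^b: the pairs formed by a variable *)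
(* x_i of x^a and a variable x_j of x^b with j < i.                           *)
Definition ninv a b : nat := (\sum_(i < n) \sum_(j < n | j < i) a i * b j)%N.

Lemma mono_sumP a b c : reflect (forall i, c i = a i + b i :> nat) (mono_sum a b c).
Proof. exact: 'forall_eqP. Qed.

Lemma ninvDl a b c d : mono_sum a b c -> ninv c d = (ninv a d + ninv b d)%N.
Proof.
move=> /mono_sumP abc; rewrite /ninv -big_split; apply: eq_bigr => i _ /=.
by rewrite -big_split; apply: eq_bigr => j _ /=; rewrite abc mulnDl.
Qed.

Lemma ninvDr a b c d : mono_sum a b c -> ninv d c = (ninv d a + ninv d b)%N.
Proof.
move=> /mono_sumP abc; rewrite /ninv -big_split; apply: eq_bigr => i _ /=.
by rewrite -big_split; apply: eq_bigr => j _ /=; rewrite abc mulnDr.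
Qed.

Lemma ninv0l a : ninv mono0 a = 0%N.
Proof. by rewrite /ninv big1// => i _; rewrite big1// => j _; rewrite ffunE. Qed.

Lemma ninv0r a : ninv a mono0 = 0%N.
Proof.
by rewrite /ninv big1// => i _; rewrite big1// => j _; rewrite ffunE muln0.
Qed.

Lemma mono_sum0l a b : mono_sum mono0 a b = (b == a).
Proof.
apply/mono_sumP/eqP => [h|-> i]; last by rewrite ffunE.
by apply/ffunP => i; have := h i; rewrite ffunE; case: (a i); case: (b i).
Qed.

Lemma mono_sum0r a b : mono_sum a mono0 b = (b == a).
Proof.
apply/mono_sumP/eqP => [h|-> i]; last by rewrite ffunE addn0.
by apply/ffunP => i; have := h i; rewrite ffunE; case: (a i); case: (b i).
Qed.

Lemma mono_sum_inj a b c d : mono_sum a b c -> mono_sum a b d -> c = d.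
Proof.
move=> /mono_sumP h /mono_sumP k; apply/ffunP => i.
by have := k i; rewrite -h; case: (c i); case: (d i).
Qed.

Lemma ninv_var i j : ninv (mono_var i) (mono_var j) = (j < i)%N.
Proof.
rewrite /ninv (bigD1 i)//= addnC big1 => [|k ki]; last first.
  by rewrite big1// => l _; rewrite !ffunE (negPf ki).
rewrite add0n; have [ji|ij] := boolP (j < i)%N.
  rewrite (bigD1 j)//= !ffunE !eqxx big1// => l /andP[_ lj].
  by rewrite !ffunE (negPf lj) muln0.
rewrite big1// => l li; rewrite !ffunE; case: (eqVneq l j) => [lj|]; last first.
  by rewrite muln0.
by rewrite lj (negPf ij) in li.
Qed.

End Exponents.

Local Open Scope classical_set_scope.
Local Open Scope ring_scope.

(* The exterior algebra of order n: an element is the family of its           *)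
(* coefficients on the basis of the monomials x^a.  The product is the        *)
(* bilinear extension of x^a x^b = (-1)^(ninv a b) x^(a+b), or 0 when a + b   *)
(* is not in {0,1}^n.                                                         *)
Record ext (F : fieldType) (n : nat) := Ext { coefx : {ffun mono n -> F} }.

HB.instance Definition _ F n := [isNew for @coefx F n].
HB.instance Definition _ F n := [Choice of ext F n by <:].

Coercion coefx : ext >-> finfun_of.

Section ExtLmodule.
Variables (F : fieldType) (n : nat).
Implicit Types f g h : ext F n.

Lemma extP f g : (forall a, f a = g a) -> f = g.
Proof. by move=> fg; apply: val_inj; apply/ffunP. Qed.

Definition ext0 : ext F n := Ext 0.
Definition extN f : ext F n := Ext (- coefx f).
Definition extD f g : ext F n := Ext (coefx f + coefx g).
Definition extZ (k : F) f : ext F n := Ext [ffun a => k * f a].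

Fact extDA : associative extD.
Proof. by move=> f g h; congr Ext; apply: addrA. Qed.
Fact extDC : commutative extD.
Proof. by move=> f g; congr Ext; apply: addrC. Qed.
Fact ext0D : left_id ext0 extD.
Proof. by move=> f; apply: val_inj; apply: add0r. Qed.
Fact extND : left_inverse ext0 extN extD.
Proof. by move=> f; apply: val_inj; apply: addNr. Qed.

HB.instance Definition _ := GRing.isZmodule.Build (ext F n) extDA extDC ext0D extND.

Fact extZA k l f : extZ k (extZ l f) = extZ (k * l) f.
Proof. by apply: extP => a; rewrite !ffunE mulrA. Qed.
Fact ext1Z : left_id 1 extZ.
Proof. by move=> f; apply: extP => a; rewrite ffunE mul1r. Qed.
Fact extZDr : right_distributive extZ +%R.
Proof. by move=> k f g; apply: extP => a; rewrite !ffunE mulrDr. Qed.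
Fact extZDl f : {morph extZ^~ f : k l / k + l}.
Proof. by move=> k l; apply: extP => a; rewrite !ffunE mulrDl. Qed.

HB.instance Definition _ :=
  GRing.Zmodule_isLmodule.Build F (ext F n) extZA ext1Z extZDr extZDl.

Lemma coefx0 a : (0 : ext F n) a = 0. Proof. by rewrite ffunE. Qed.
Lemma coefxN f a : (- f) a = - f a. Proof. by rewrite ffunE. Qed.
Lemma coefxD f g a : (f + g) a = f a + g a. Proof. by rewrite ffunE. Qed.
Lemma coefxZ k f a : (k *: f) a = k * f a. Proof. by rewrite ffunE. Qed.

End ExtLmodule.

Section ExtAlgebra.
Variables (F : fieldType) (n : nat).
Implicit Types f g h : ext F n.
Implicit Types a b c d : mono n.

Definition xmono a : ext F n := Ext [ffun b => (b == a)%:R].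

Definition struct_coef a b c : F := if mono_sum a b c then (-1) ^+ ninv a b else 0.

Definition extM f g : ext F n :=
  Ext [ffun c => \sum_a \sum_b f a * g b * struct_coef a b c].

Lemma struct_coefAl a b c d :
  \sum_e struct_coef a b e * struct_coef e c d =
  if [forall i, d i == a i + b i + c i :> nat]%N
  then (-1) ^+ (ninv a b + ninv a c + ninv b c) else 0 :> F.
Proof.
case: ifP => [/'forall_eqP h|/negP h].
- have s1 : mono_sum a b [ffun i => a i || b i].
    apply/mono_sumP => i; rewrite ffunE; have := h i.
    by case: (a i); case: (b i); case: (c i); case: (d i).
  rewrite (bigD1 [ffun i => a i || b i])//= big1 ?addr0 => [|e ne]; last first.
    rewrite /struct_coef; case: ifP => [s2|]; last by rewrite mul0r.
    by rewrite (mono_sum_inj s1 s2) eqxx in ne.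
  have s2 : mono_sum [ffun i => a i || b i] c d.
    by apply/mono_sumP => i; rewrite h (mono_sumP _ _ _ s1).
  by rewrite /struct_coef s1 s2 (ninvDl _ s1) -exprD addnA.
- rewrite big1// => e _; rewrite /struct_coef.
  case: ifP => [/mono_sumP s1|]; last by rewrite mul0r.
  case: ifP => [/mono_sumP s2|]; last by rewrite mulr0.
  by case: h; apply/'forall_eqP => i; rewrite s2 s1.
Qed.

Lemma struct_coefAr a b c d :
  \sum_e struct_coef b c e * struct_coef a e d =
  if [forall i, d i == a i + b i + c i :> nat]%N
  then (-1) ^+ (ninv a b + ninv a c + ninv b c) else 0 :> F.
Proof.
case: ifP => [/'forall_eqP h|/negP h].
- have s1 : mono_sum b c [ffun i => b i || c i].
    apply/mono_sumP => i; rewrite ffunE; have := h i.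
    by case: (a i); case: (b i); case: (c i); case: (d i).
  rewrite (bigD1 [ffun i => b i || c i])//= big1 ?addr0 => [|e ne]; last first.
    rewrite /struct_coef; case: ifP => [s2|]; last by rewrite mul0r.
    by rewrite (mono_sum_inj s1 s2) eqxx in ne.
  have s2 : mono_sum a [ffun i => b i || c i] d.
    by apply/mono_sumP => i; rewrite h (mono_sumP _ _ _ s1) addnA.
  by rewrite /struct_coef s1 s2 (ninvDr _ s1) -exprD addnC.
- rewrite big1// => e _; rewrite /struct_coef.
  case: ifP => [/mono_sumP s1|]; last by rewrite mul0r.
  case: ifP => [/mono_sumP s2|]; last by rewrite mulr0.
  by case: h; apply/'forall_eqP => i; rewrite s2 s1 addnA.
Qed.

Fact extMA : associative extM.
Proof.
move=> f g h; apply: extP => d; rewrite !ffunE.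
transitivity (\sum_a \sum_b \sum_c
    f a * g b * h c * \sum_e struct_coef b c e * struct_coef a e d).
  apply: eq_bigr => a _.
  transitivity (\sum_e \sum_b \sum_c
      f a * g b * h c * (struct_coef b c e * struct_coef a e d)).
    apply: eq_bigr => e _; rewrite ffunE mulr_sumr mulr_suml.
    apply: eq_bigr => b _; rewrite mulr_sumr mulr_suml.
    by apply: eq_bigr => c _; rewrite !mulrA.
  rewrite exchange_big; apply: eq_bigr => b _.
  by rewrite exchange_big; apply: eq_bigr => c _; rewrite mulr_sumr.
transitivity (\sum_e \sum_c \sum_a \sum_b
    f a * g b * h c * (struct_coef a b e * struct_coef e c d)); last first.
  apply: eq_bigr => e _; apply: eq_bigr => c _; rewrite ffunE !mulr_suml.
  apply: eq_bigr => a _; rewrite !mulr_suml.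
  by apply: eq_bigr => b _; rewrite !mulrA; congr (_ * _); rewrite mulrAC.
under [RHS]eq_bigr => e _ do rewrite exchange_big /=.
rewrite [RHS]exchange_big; apply: eq_bigr => a _.
under [RHS]eq_bigr => e _ do rewrite exchange_big /=.
rewrite [RHS]exchange_big; apply: eq_bigr => b _.
rewrite [RHS]exchange_big; apply: eq_bigr => c _.
by rewrite -mulr_sumr struct_coefAl struct_coefAr.
Qed.

Fact ext1M : left_id (xmono (mono0 n)) extM.
Proof.
move=> f; apply: extP => c; rewrite ffunE (bigD1 (mono0 n))//= [X in _ + X]big1.
  rewrite addr0 (bigD1 c)//= big1 => [|b bc].
    by rewrite ffunE /struct_coef mono_sum0l !eqxx ninv0l mul1r mulr1 addr0.
  by rewrite /struct_coef mono_sum0l eq_sym (negPf bc) mulr0.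
by move=> a /negPf a0; rewrite big1// => b _; rewrite ffunE a0 !mul0r.
Qed.

Fact extM1 : right_id (xmono (mono0 n)) extM.
Proof.
move=> f; apply: extP => c; rewrite ffunE exchange_big.
rewrite (bigD1 (mono0 n))//= [X in _ + X]big1.
  rewrite addr0 (bigD1 c)//= big1 => [|b bc].
    by rewrite ffunE /struct_coef mono_sum0r !eqxx ninv0r !mulr1 addr0.
  by rewrite /struct_coef mono_sum0r eq_sym (negPf bc) mulr0.
by move=> a /negPf a0; rewrite big1// => b _; rewrite ffunE a0 mulr0 mul0r.
Qed.

Fact extMDl : left_distributive extM +%R.
Proof.
move=> f g h; apply: extP => c; rewrite coefxD !ffunE -big_split /=.
apply: eq_bigr => a _; rewrite -big_split /=; apply: eq_bigr => b _.
by rewrite coefxD !mulrDl.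
Qed.

Fact extMDr : right_distributive extM +%R.
Proof.
move=> f g h; apply: extP => c; rewrite coefxD !ffunE -big_split /=.
apply: eq_bigr => a _; rewrite -big_split /=; apply: eq_bigr => b _.
by rewrite coefxD mulrDr mulrDl.
Qed.

Fact ext1_neq0 : xmono (mono0 n) != 0.
Proof.
apply/eqP => /(congr1 (fun f : ext F n => f (mono0 n))).
by rewrite coefx0 ffunE eqxx => /eqP; rewrite oner_eq0.
Qed.

HB.instance Definition _ :=
  GRing.Zmodule_isNzRing.Build (ext F n) extMA ext1M extM1 extMDl extMDr ext1_neq0.

Fact extZMl k f g : k *: (f * g) = k *: f * g.
Proof.
apply: extP => c; rewrite coefxZ !ffunE mulr_sumr; apply: eq_bigr => a _.
by rewrite mulr_sumr; apply: eq_bigr => b _; rewrite coefxZ !mulrA.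
Qed.

HB.instance Definition _ := GRing.Lmodule_isLalgebra.Build F (ext F n) extZMl.

Fact extZMr k f g : k *: (f * g) = f * (k *: g).
Proof.
apply: extP => c; rewrite coefxZ !ffunE mulr_sumr; apply: eq_bigr => a _.
rewrite mulr_sumr; apply: eq_bigr => b _.
by rewrite coefxZ !mulrA [k * _]mulrC.
Qed.

HB.instance Definition _ := GRing.Lalgebra_isAlgebra.Build F (ext F n) extZMr.

Lemma coefxM f g c : (f * g) c = \sum_a \sum_b f a * g b * struct_coef a b c.
Proof. by rewrite ffunE. Qed.

Definition xvar (i : 'I_n) : ext F n := xmono (mono_var i).

Lemma ext_basis f : f = \sum_a f a *: xmono a.
Proof.
apply: extP => b; rewrite (big_morph (fun g : ext F n => g b)
  (fun g h => coefxD g h b) (coefx0 F b)) (bigD1 b) // big1 => [|a ab].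
  by rewrite coefxZ [X in _ * X]ffunE eqxx mulr1 /= addr0.
by rewrite coefxZ [X in _ * X]ffunE eq_sym (negPf ab) mulr0.
Qed.

Lemma coefx_xmonoM a b c : (xmono a * xmono b) c = struct_coef a b c.
Proof.
rewrite coefxM (bigD1 a)//= [X in _ + X]big1 ?addr0; last first.
  by move=> d /negPf da; rewrite big1// => e _; rewrite ffunE da !mul0r.
rewrite (bigD1 b)//= big1 ?addr0 => [|d /negPf db].
  by rewrite !ffunE !eqxx !mul1r.
by rewrite [X in _ * X * _]ffunE db mulr0 mul0r.
Qed.

Lemma xmonoM a b c : mono_sum a b c -> xmono a * xmono b = (-1) ^+ ninv a b *: xmono c.
Proof.
move=> abc; apply: extP => d; rewrite coefx_xmonoM coefxZ ffunE /struct_coef.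
case: eqVneq => [->|dc]; first by rewrite abc mulr1.
by case: ifP => [abd|]; rewrite ?mulr0// (mono_sum_inj abc abd) eqxx in dc *.
Qed.

Lemma xvar_sqr i : xvar i * xvar i = 0.
Proof.
apply: extP => c; rewrite coefx_xmonoM coefx0 /struct_coef.
by case: ifP => // /mono_sumP /(_ i); rewrite !ffunE eqxx; case: (c i).
Qed.

Lemma xvar_anticomm i j : xvar i * xvar j = - (xvar j * xvar i).
Proof.
have [->|ij] := eqVneq i j; first by rewrite xvar_sqr oppr0.
apply: extP => c; rewrite coefxN !coefx_xmonoM /struct_coef !ninv_var.
have -> : mono_sum (mono_var j) (mono_var i) c = mono_sum (mono_var i) (mono_var j) c.
  by apply: eq_forallb => k; rewrite addnC.
case: ifP => _; last by rewrite oppr0.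
have: i != j :> nat := ij.
by case: ltngtP => //= _ _; rewrite ?opprK.
Qed.

Lemma xmonoE a : xmono a = \prod_(i < n) xvar i ^+ a i.
Proof.
suff H (s : seq 'I_n) : sorted ltn [seq val i | i <- s] ->
    \prod_(i <- s) xvar i ^+ a i = xmono [ffun i => (i \in s) && a i].
  rewrite H.
    by congr xmono; apply/ffunP => i; rewrite ffunE mem_index_enum.
  by rewrite -[index_enum _]enumT val_enum_ord iota_ltn_sorted.
elim: s => [_|i s IH] /=.
  by rewrite big_nil; congr xmono; apply/ffunP => i; rewrite !ffunE.
rewrite (path_sortedE ltn_trans) => /andP[/allP lti /IH {}IH].
rewrite big_cons IH; have is_ : i \notin s.
  by apply/negP => si; have := lti i (map_f _ si); rewrite /= ltnn.
have [ai|ai] := boolP (a i); last first.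
  rewrite expr0 mul1r; congr xmono; apply/ffunP => j; rewrite !ffunE inE.
  by case: eqVneq => [->|//]; rewrite (negPf ai) !andbF.
rewrite expr1 (@xmonoM _ _ [ffun j => (j \in i :: s) && a j]).
  rewrite [ninv _ _]big1 ?scale1r// => j _; rewrite big1// => k kj.
  rewrite !ffunE; case: eqVneq => [ji|]//; rewrite ?mul1n.
  case: (boolP (k \in s)) => //= ks; have := lti k (map_f _ ks).
  by rewrite /= -ji ltnNge ltnW.
apply/mono_sumP => j; rewrite !ffunE inE.
by case: eqVneq => [->|//]; rewrite (negPf is_) ai.
Qed.

End ExtAlgebra.

Arguments xmono {F n} a.
Arguments xvar {F n} i.

Section TermOrders.
Variable n : nat.
Implicit Types (lt : rel (mono n)) (a b : mono n).

Definition strict_total_order lt : Prop :=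
  [/\ irreflexive lt, transitive lt & forall a b, a != b -> lt a b || lt b a].

Definition term_order lt : Prop :=
  [/\ strict_total_order lt,
      forall a, a != mono0 n -> lt (mono0 n) a &
      forall (a b a' b' : mono n) (c : 'I_n -> nat),
        (forall i, a' i = a i + c i :> nat)%N ->
        (forall i, b' i = b i + c i :> nat)%N ->
        lt a b -> lt a' b'].

Definition dot (R : realType) (w : 'rV[R]_n) a : R := \sum_(i < n) w 0 i * (a i)%:R.

Definition coherent (R : realType) lt : Prop :=
  exists w : 'rV[R]_n, forall a b, lt a b -> dot w a < dot w b.

End TermOrders.

Section InitialIdeals.
Variables (F : fieldType) (n : nat).
Implicit Types (lt : rel (mono n)) (f : ext F n) (I : set (ext F n)).

Definition left_ideal I : Prop :=
  [/\ I 0, forall f g, I f -> I g -> I (f + g) & forall h f, I f -> I (h * f)].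

Definition two_sided_ideal I : Prop :=
  left_ideal I /\ forall f h, I f -> I (f * h).

Definition homog_part (d : nat) f : ext F n := \sum_(a | mdeg a == d) f a *: xmono a.

Definition homogeneous I : Prop := forall f d, I f -> I (homog_part d f).

(* x^a is the initial monomial of f; this forces f to be nonzero. *)
Definition is_initial lt f a : Prop :=
  f a != 0 /\ forall b, f b != 0 -> b != a -> lt b a.

Definition left_ideal_gen (S : set (ext F n)) : set (ext F n) := smallest left_ideal S.

Definition initial_ideal lt I : set (ext F n) :=
  left_ideal_gen [set xmono a | a in [set a | exists2 f, I f & is_initial lt f a]].

(* The real numbers R only enter through the coherence of term orders. *)
Definition noncoherent_initial_ideal (R : realType) lt I : Prop :=
  forall ltc : rel (mono n), term_order ltc -> coherent R ltc ->
    initial_ideal lt I <> initial_ideal ltc I.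

End InitialIdeals.

(* Main.v *)
Require Import Defs.
From mathcomp Require Import all_boot all_order all_algebra.
From mathcomp Require Import classical_sets reals.
Local Open Scope ring_scope.

Set Implicit Arguments.
Unset Strict Implicit.
Unset Printing Implicit Defensive.

Import Order.TTheory GRing.Theory Num.Theory.

(** Number the variables from 0.  Give x0, x1, x2 generic weights p, q, r and
    give x3, x4, x5 the weights q + r - p, p + r - q, p + q - r.  By genericity,
    the only ties between squarefree monomials are then, up to common factors,
    the four forced by linear algebra:
      x1 x2 and x0 x3,   x0 x2 and x1 x4,   x0 x1 and x2 x5,
      x3 x4 x5 and x0 x1 x2.
    The sum of the exponent differences of two of these ties, each taken with
    either sign, leaves the cube of vectors with entries -1, 0, 1 unless it is
    zero, so two tie breaking rules can never be chained.  Each tie may hence be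
    broken in either direction, independently of the others, and the result is a
    term order [exchange_lt_term_order].  Let the second monomial win in each of
    the four.  The four exponent differences then sum to zero, hence no linear
    functional is positive on all of them and the order is noncoherent
    [balanced_not_coherent].

    To let an initial ideal remember the four comparisons, multiply them by common
    factors so that they become comparisons lo k < hi k of eight distinct cubic
    monomials.  The ideal spanned by the binomials hi k - lo k and by everything
    of degree at least 4 has initial monomials hi k, and no lo k, in degree 3.  A
    term order with the same initial ideal must pick hi k as the initial monomial
    of hi k - lo k, since the other choice puts lo k in the initial ideal; it thus
    makes the same four comparisons [same_initial_ideal_exchange] and is not
    coherent either. *)

(** * Breaking the ties of a weight by exchanges *)

Section ExchangeOrder.
Variables (n m : nat) (wt : 'I_n -> nat) (lo hi : 'I_m -> mono n).
Implicit Types a b c : mono n.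

Definition weight a : nat := (\sum_i wt i * a i)%N.

(** The equation b - a = hi k - lo k, written without subtraction: the pairs
    (a, b) and (lo k, hi k) agree once the common factors of each are cancelled. *)
Definition exchange k a b : bool := [forall i, a i + hi k i == b i + lo k i :> nat]%N.

Definition exchange_lt a b : bool :=
  (weight a < weight b)%N || [exists k, exchange k a b].

Lemma weight_exchange k a b :
  weight (lo k) = weight (hi k) -> exchange k a b -> weight a = weight b.
Proof.
move=> lohi /'forall_eqP ab; apply: (@addIn (weight (hi k))).
rewrite -{2}lohi /weight -!big_split /=.
by apply: eq_bigr => i _; rewrite -!mulnDr ab.
Qed.

(** At the coordinate i the differences of the exchanges k and l add up to 2 or
    -2, which is out of reach for a difference of exponents in {0, 1}. *)
Lemma exchange_not_composable k l a b c :
  (exists i, (hi k i && hi l i && ~~ (lo k i || lo l i))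
          || (lo k i && lo l i && ~~ (hi k i || hi l i))) ->
  exchange k a b -> ~~ exchange l b c.
Proof.
move=> [i ikl] /forallP/(_ i) ab; apply/negP => /forallP/(_ i).
by move: ikl ab; case: (hi k i) (hi l i) (lo k i) (lo l i) (a i) (b i) (c i)
  => [] [] [] [] [] [] [].
Qed.

(** Comparisons depend on exponent differences only, so they are compatible with
    multiplication; transitivity is where the exchanges could go wrong, and there
    two exchanges in a row never occur.  The case k = l, a = b = c of the same
    argument gives irreflexivity. *)
Lemma exchange_lt_term_order :
  (forall i, 0 < wt i)%N ->
  (forall k, weight (lo k) = weight (hi k)) ->
  (forall k l, exists i, (hi k i && hi l i && ~~ (lo k i || lo l i))
                      || (lo k i && lo l i && ~~ (hi k i || hi l i))) ->
  (forall a b, weight a = weight b -> a != b ->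
     exists k, exchange k a b || exchange k b a) ->
  term_order exchange_lt.
Proof.
move=> wt_gt0 lohi clash ties.
have notcomp k l a b c : exchange k a b -> exchange l b c -> False.
  by move=> ab bc; have := exchange_not_composable c (clash k l) ab; rewrite bc.
split.
- split.
  + move=> a; rewrite /exchange_lt ltnn; apply/existsP => -[k kaa].
    exact: (notcomp _ _ _ _ _ kaa kaa).
  + move=> b a c /orP[ab|/existsP[k kab]] /orP[bc|/existsP[l lbc]];
      apply/orP; try left.
    * exact: ltn_trans ab bc.
    * by rewrite -(weight_exchange (lohi l) lbc).
    * by rewrite (weight_exchange (lohi k) kab).
    * by case: (notcomp _ _ _ _ _ kab lbc).
  + move=> a b ab; rewrite /exchange_lt.
    case: (ltngtP (weight a) (weight b)) => wab; rewrite ?orbT //=.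
    have [k /orP[kab|kba]] := ties _ _ wab ab; apply/orP; [left|right];
      by apply/existsP; exists k.
- move=> a a0; apply/orP; left; rewrite /weight big1 => [|i _]; last first.
    by rewrite ffunE muln0.
  rewrite lt0n sum_nat_eq0; apply: contra a0 => /forallP a0.
  apply/eqP/ffunP => i; rewrite ffunE; have := a0 i; rewrite muln_eq0.
  by rewrite -[wt i == 0%N]negbK -lt0n wt_gt0 /=; case: (a i).
- move=> a b a' b' c ac bc /orP[ab|/existsP[k /forallP kab]]; apply/orP.
    left; move: ab; rewrite /weight -(ltn_add2r (\sum_i wt i * c i)).
    rewrite -!big_split /=; congr (_ < _)%N; apply: eq_bigr => i _.
      by rewrite ac mulnDr.
    by rewrite bc mulnDr.
  right; apply/existsP; exists k; apply/forallP => i.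
  by rewrite ac bc addnAC (eqP (kab i)) addnAC.
Qed.

End ExchangeOrder.

(** * Truncated left ideals of the exterior algebra *)

Lemma mdeg_sum n (a b c : mono n) : mono_sum a b c -> mdeg c = (mdeg a + mdeg b)%N.
Proof.
by move=> /mono_sumP abc; rewrite /mdeg -big_split; apply: eq_bigr => i _.
Qed.

Lemma mdeg_eq0 n (a : mono n) : (mdeg a == 0%N) = (a == mono0 n).
Proof.
rewrite /mdeg sum_nat_eq0; apply/forallP/eqP => [a0|-> i]; last by rewrite ffunE.
by apply/ffunP => i; rewrite ffunE; have := a0 i; case: (a i).
Qed.

Section LowDegree.
Variables (F : fieldType) (n d : nat).
Implicit Types (f h : ext F n) (a b c : mono n).

(** The lowest degree part of f only sees the constant term of a multiplier. *)
Lemma coefxMl_low f h c : (forall b, (mdeg b < d)%N -> f b = 0) ->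
  (mdeg c <= d)%N -> (h * f) c = h (mono0 n) * f c.
Proof.
move=> f0 cd; rewrite coefxM (bigD1 (mono0 n))//= [X in _ + X]big1 ?addr0; last first.
  move=> a a0; rewrite big1// => b _; rewrite /struct_coef.
  case: ifP => [/mdeg_sum cab|]; last by rewrite mulr0.
  rewrite (f0 b) ?mulr0 ?mul0r//; apply: leq_trans cd; rewrite cab.
  by rewrite -[X in (X < _)%N]add0n ltn_add2r lt0n mdeg_eq0.
rewrite (bigD1 c)//= big1 ?addr0 => [|b bc].
  by rewrite /struct_coef mono_sum0l eqxx ninv0l mulr1.
by rewrite /struct_coef mono_sum0l eq_sym (negPf bc) mulr0.
Qed.

Lemma coefxMr_low f h c : (forall b, (mdeg b < d)%N -> f b = 0) ->
  (mdeg c <= d)%N -> (f * h) c = f c * h (mono0 n).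
Proof.
move=> f0 cd; rewrite coefxM exchange_big (bigD1 (mono0 n))//=.
rewrite [X in _ + X]big1 ?addr0; last first.
  move=> a a0; rewrite big1// => b _; rewrite /struct_coef.
  case: ifP => [/mdeg_sum cab|]; last by rewrite mulr0.
  rewrite (f0 b) ?mulr0 ?mul0r//; apply: leq_trans cd; rewrite cab.
  by rewrite -[X in (X < _)%N]addn0 ltn_add2l lt0n mdeg_eq0.
rewrite (bigD1 c)//= big1 ?addr0 => [|b bc].
  by rewrite /struct_coef mono_sum0r eqxx ninv0r mulr1.
by rewrite /struct_coef mono_sum0r eq_sym (negPf bc) mulr0.
Qed.

Lemma homog_partE e f a : homog_part e f a = if mdeg a == e then f a else 0.
Proof.
rewrite /homog_part (big_morph (fun g : ext F n => g a)
  (fun g h => coefxD g h a) (coefx0 F a)).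
case: ifP => ae.
  rewrite (bigD1 a) // big1 => [|b /andP[_ ba]].
    by rewrite coefxZ [X in _ * X]ffunE eqxx mulr1 /= addr0.
  by rewrite coefxZ [X in _ * X]ffunE eq_sym (negPf ba) mulr0.
rewrite big1// => b be; rewrite coefxZ [X in _ * X]ffunE.
by case: eqP => [ab|]; rewrite ?mulr0//; rewrite ab be in ae.
Qed.

(** The span of the monomials that lie in S or have degree greater than d. *)
Definition low_support (S : pred (mono n)) : set (ext F n) :=
  [set f | forall a, (mdeg a <= d)%N -> a \notin S -> f a = 0]%classic.

Lemma low_support_left_ideal (S : pred (mono n)) :
  (forall a, a \in S -> mdeg a = d) -> left_ideal (low_support S).
Proof.
move=> Sd; split=> [a _ _|f g f0 g0 a ad aS|h f f0 a ad aS]; first exact: coefx0.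
  by rewrite coefxD f0// g0// addr0.
rewrite coefxMl_low// ?f0 ?mulr0// => b bd; apply: f0; first exact: ltnW.
by apply/negP => /Sd bd'; rewrite bd' ltnn in bd.
Qed.

End LowDegree.

(** * The ideal of the binomials hi k - lo k *)

Section ExchangeIdeal.
Variables (F : fieldType) (n m d : nat) (lo hi : 'I_m -> mono n).
Hypotheses (lo_deg : forall k, mdeg (lo k) = d) (hi_deg : forall k, mdeg (hi k) = d).
Implicit Types (f g h : ext F n) (a b c : mono n) (lt : rel (mono n)).

(** When the monomials lo k and hi k are all distinct, this is the span of the
    binomials hi k - lo k and of the monomials of degree greater than d; linear
    equations on coefficients make membership immediate to test. *)
Definition exchange_ideal : set (ext F n) :=
  [set f | low_support d [pred a | (a \in codom lo) || (a \in codom hi)] f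
         /\ forall k, f (hi k) = - f (lo k)]%classic.

Let supp_deg a : (a \in codom lo) || (a \in codom hi) -> mdeg a = d.
Proof. by case/orP => /codomP[k ->]. Qed.

Let low0 f : exchange_ideal f -> forall b, (mdeg b < d)%N -> f b = 0.
Proof.
move=> [f0 _] b bd; apply: f0; first exact: ltnW.
by apply/negP => /supp_deg bd'; rewrite bd' ltnn in bd.
Qed.

Lemma exchange_ideal_two_sided : two_sided_ideal exchange_ideal.
Proof.
have [supp0 suppD suppM] := low_support_left_ideal F supp_deg.
split; first split=> [|f g [fs fE] [gs gE]|h f If].
- by split=> // k; rewrite !coefx0 oppr0.
- by split=> [|k]; [exact: suppD | rewrite !coefxD fE gE opprD].
- split=> [|k]; first by apply: suppM; case: If.
  by rewrite !(coefxMl_low _ (low0 If)) ?lo_deg ?hi_deg// If.2 mulrN.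
move=> f h If; split=> [a ad aS|k].
  by rewrite (coefxMr_low _ (low0 If))// If.1 ?mul0r.
by rewrite !(coefxMr_low _ (low0 If)) ?lo_deg ?hi_deg// If.2 mulNr.
Qed.

Lemma exchange_ideal_homogeneous : homogeneous exchange_ideal.
Proof.
move=> f e [fs fE]; split=> [a ad aS|k]; rewrite !homog_partE ?lo_deg ?hi_deg.
  by case: ifP => // _; apply: fs.
by case: ifP; rewrite ?oppr0.
Qed.

(** If lo k occurs in an element of the ideal then so does the larger hi k, so lo k
    is never initial. *)
Lemma initial_ideal_exchange_low_support lt : irreflexive lt -> transitive lt ->
    (forall k, lt (lo k) (hi k)) ->
  (initial_ideal lt exchange_ideal `<=` low_support d (mem (codom hi)))%classic.
Proof.
move=> ltxx lt_trans lohi f If; apply: If; split.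
  by apply: low_support_left_ideal => a /codomP[k ->].
move=> _ [a [g [gs gE] [ga0 a_max]] <-] b bd bhi; rewrite ffunE.
have [ba|//] := eqVneq b a; case/negP: (ga0); apply/eqP.
rewrite ba in bd bhi => {b ba}; apply: gs => //; rewrite inE (negPf bhi) orbF.
apply/codomP => -[k ak]; have hik : hi k != a.
  by apply: contraNneq bhi => <-; apply: codom_f.
have /a_max/(_ hik) : g (hi k) != 0.
  by rewrite gE -ak oppr_eq0 ga0.
by move=> /(lt_trans _ _ _ (lohi k)); rewrite ak ltxx.
Qed.

Hypotheses (lo_inj : injective lo) (hi_inj : injective hi).
Hypothesis lohi_disj : forall k l, lo k != hi l.

Lemma exchange_ideal_binomial k : exchange_ideal (xmono (hi k) - xmono (lo k)).
Proof.
split=> [a ad|l].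
  rewrite inE negb_or => /andP[alo ahi]; rewrite coefxD coefxN !ffunE.
  have /negPf-> : a != hi k by apply: contraNneq ahi => ->; apply: codom_f.
  have /negPf-> : a != lo k by apply: contraNneq alo => ->; apply: codom_f.
  by rewrite subrr.
rewrite !coefxD !coefxN !ffunE (inj_eq hi_inj) (inj_eq lo_inj).
by rewrite [hi l == _]eq_sym !(negbTE (lohi_disj _ _)) subr0 sub0r opprK.
Qed.

(** The initial monomial of hi k - lo k for ltc is one of hi k and lo k, and lo k
    is not in the initial ideal for lt. *)
Lemma same_initial_ideal_exchange lt ltc :
    term_order lt -> (forall k, lt (lo k) (hi k)) -> term_order ltc ->
    initial_ideal lt exchange_ideal = initial_ideal ltc exchange_ideal ->
  forall k, ltc (lo k) (hi k).
Proof.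
move=> [[ltxx lt_trans _] _ _] lohi [[_ _ tot] _ _] same k.
have /orP[//|hilo] := tot _ _ (lohi_disj k k).
have : low_support d (mem (codom hi)) (xmono (lo k) : ext F n).
  apply: (initial_ideal_exchange_low_support ltxx lt_trans lohi); rewrite same.
  move=> J [_]; apply; exists (lo k) => //.
  exists (xmono (hi k) - xmono (lo k)); first exact: exchange_ideal_binomial.
  have val a : (xmono (hi k) - xmono (lo k) : ext F n) a
      = (a == hi k)%:R - (a == lo k)%:R by rewrite coefxD coefxN !ffunE.
  split=> [|b]; first by rewrite val eqxx (negPf (lohi_disj _ _)) sub0r oppr_eq0 oner_eq0.
  rewrite val => + /negPf blo; rewrite blo subr0.
  by have [->|] := eqVneq b (hi k); rewrite ?eqxx.
move=> /(_ (lo k)); rewrite lo_deg leqnn ffunE eqxx => /(_ isT) lok0.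
have /lok0/eqP : lo k \notin codom hi.
  by apply/codomP => -[l /eqP]; rewrite (negPf (lohi_disj _ _)).
by rewrite oner_eq0.
Qed.

End ExchangeIdeal.

(** Summing w . lo k < w . hi k over k gives a strict inequality between two
    equal numbers. *)
Lemma balanced_not_coherent (R : realType) n m (lo hi : 'I_m.+1 -> mono n)
    (lt : rel (mono n)) :
  (forall i, \sum_k lo k i = \sum_k hi k i :> nat)%N ->
  (forall k, lt (lo k) (hi k)) -> ~ coherent R lt.
Proof.
move=> bal lohi [w wlt].
have : \sum_k dot w (lo k) < \sum_k dot w (hi k).
  apply: ltr_sum => [|k _]; first by apply/hasP; exists ord0; rewrite ?mem_index_enum.
  exact: wlt.
rewrite /dot exchange_big [X in _ < X]exchange_big /=.
have -> : \sum_i \sum_k w 0 i * (lo k i)%:R = \sum_i \sum_k w 0 i * (hi k i)%:R.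
  by apply: eq_bigr => i _; rewrite -!mulr_sumr -!natr_sum bal.
by rewrite ltxx.
Qed.

(** * Four exchanges in six variables *)

Definition mono_of (s : seq nat) : mono 6 := [ffun i => val i \in s].

(** The four ties of the weight, the first three multiplied by x4, x5 and x3
    respectively: these factors make all monomials cubic and keep the eight of
    them distinct. *)
Definition exchange_pairs : seq (seq nat * seq nat) :=
  [:: ([:: 1; 2; 4], [:: 0; 3; 4]); ([:: 0; 2; 5], [:: 1; 4; 5]);
      ([:: 0; 1; 3], [:: 2; 5; 3]); ([:: 3; 4; 5], [:: 0; 1; 2])]%N.

Definition exchange_pair (k : nat) := nth ([::], [::]) exchange_pairs k.
Definition lo6 (k : 'I_4) := mono_of (exchange_pair k).1.
Definition hi6 (k : 'I_4) := mono_of (exchange_pair k).2.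
(** p, q, r, q + r - p, p + r - q, p + q - r for p = 3, q = 13, r = 15, which are
    generic enough for squarefree monomials to have no other ties. *)
Definition wt6 (i : 'I_6) : nat := nth 0%N [:: 3; 13; 15; 25; 5; 1]%N i.

Lemma forall_ordP n (p : pred nat) : reflect (forall i : 'I_n, p i) (all p (iota 0 n)).
Proof.
apply: (iffP allP) => [ap i|ap i]; first by apply: ap; rewrite mem_iota ltn_ord.
by rewrite mem_iota => lein; apply: (ap (Ordinal lein)).
Qed.

Lemma exists_ordP n (p : pred nat) : reflect (exists i : 'I_n, p i) (has p (iota 0 n)).
Proof.
apply: (iffP hasP) => [[i]|[i pi]]; last by exists (val i); rewrite ?mem_iota ?ltn_ord.
by rewrite mem_iota => lein pi; exists (Ordinal lein).
Qed.

Lemma pair_balanced (i : 'I_6) : (\sum_k lo6 k i = \sum_k hi6 k i :> nat)%N.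
Proof.
rewrite !big_ord_recl !big_ord0 !ffunE.
by case: i => [[|[|[|[|[|[|]]]]]] lti].
Qed.

Lemma mdeg_lo6 k : mdeg (lo6 k) = 3%N.
Proof.
rewrite /mdeg !big_ord_recl big_ord0 !ffunE.
by case: k => [[|[|[|[|]]]] ltk].
Qed.

Lemma mdeg_hi6 k : mdeg (hi6 k) = 3%N.
Proof.
rewrite /mdeg !big_ord_recl big_ord0 !ffunE.
by case: k => [[|[|[|[|]]]] ltk].
Qed.

Lemma weight_lo6 k : weight wt6 (lo6 k) = weight wt6 (hi6 k).
Proof.
rewrite /weight !big_ord_recl !big_ord0 !ffunE.
by case: k => [[|[|[|[|]]]] ltk].
Qed.

Lemma mono_of_eq_mem s t : mono_of s = mono_of t ->
  all (fun i => (i \in s) == (i \in t)) (iota 0 6).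
Proof.
move=> st; apply/(forall_ordP 6 (fun i => (i \in s) == (i \in t))) => i; apply/eqP.
by move/ffunP/(_ i): st; rewrite !ffunE.
Qed.

Lemma lo6_inj : injective lo6.
Proof.
move=> [[|[|[|[|//]]]] ltk] [[|[|[|[|//]]]] ltl] /mono_of_eq_mem // _; exact: val_inj.
Qed.

Lemma hi6_inj : injective hi6.
Proof.
move=> [[|[|[|[|//]]]] ltk] [[|[|[|[|//]]]] ltl] /mono_of_eq_mem // _; exact: val_inj.
Qed.

Lemma lo6_neq_hi6 k l : lo6 k != hi6 l.
Proof.
by apply/eqP; move: k l => [[|[|[|[|//]]]] ltk] [[|[|[|[|//]]]] ltl] /mono_of_eq_mem.
Qed.

Lemma pair_clash (k l : 'I_4) :
  exists i, (hi6 k i && hi6 l i && ~~ (lo6 k i || lo6 l i))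
         || (lo6 k i && lo6 l i && ~~ (hi6 k i || hi6 l i)).
Proof.
suff /exists_ordP[i kl] : has (fun i =>
       ((i \in (exchange_pair k).2) && (i \in (exchange_pair l).2)
         && ~~ ((i \in (exchange_pair k).1) || (i \in (exchange_pair l).1)))
    || ((i \in (exchange_pair k).1) && (i \in (exchange_pair l).1)
         && ~~ ((i \in (exchange_pair k).2) || (i \in (exchange_pair l).2)))) (iota 0 6).
  by exists i; rewrite !ffunE.
by move: k l => [[|[|[|[|//]]]] ltk] [[|[|[|[|//]]]] ltl].
Qed.

(** * Exhaustive search for the ties of the weight *)

(** Finite functions do not evaluate inside the kernel, so the exhaustive search
    for ties runs on lists of bits. *)
Fixpoint all_bits n (p : pred (seq bool)) : bool :=
  if n is n'.+1 then all_bits n' (p \o cons true) && all_bits n' (p \o cons false)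
  else p [::].

Lemma all_bitsP n p s : all_bits n p -> size s = n -> p s.
Proof.
elim: n p s => [|n IHn] p [|b s] //= /andP[pt pf] [ssz].
by case: b; [apply: (IHn (p \o cons true)) | apply: (IHn (p \o cons false))].
Qed.

Lemma sum_ordE n (f : nat -> nat) : (\sum_(i < n) f i = sumn [seq f i | i <- iota 0 n])%N.
Proof. by rewrite sumnE big_map -val_enum_ord big_map big_enum. Qed.

Definition seq_weight (s : seq bool) : nat :=
  sumn [seq (nth 0 [:: 3; 13; 15; 25; 5; 1] i * nth false s i)%N | i <- iota 0 6]%N.

Definition seq_exchange (k : nat) (s t : seq bool) : bool :=
  all (fun i => nth false s i + (i \in (exchange_pair k).2)
             == nth false t i + (i \in (exchange_pair k).1))%N (iota 0 6).

Lemma seq_ties : all_bits 6 (fun s => all_bits 6 (fun t =>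
  (seq_weight s == seq_weight t) ==> (s != t) ==>
  has (fun k => seq_exchange k s t || seq_exchange k t s) (iota 0 4))).
Proof. by vm_compute. Qed.

Definition bits (a : mono 6) : seq bool := [seq a i | i <- enum 'I_6].

Lemma size_bits a : size (bits a) = 6%N.
Proof. by rewrite size_map size_enum_ord. Qed.

Lemma nth_bits a (i : 'I_6) : nth false (bits a) i = a i.
Proof. by rewrite (nth_map i) ?size_enum_ord// nth_ord_enum. Qed.

Lemma seq_weight_bits a : seq_weight (bits a) = weight wt6 a.
Proof.
rewrite /seq_weight -(sum_ordE 6 (fun i => _)).
by apply: eq_bigr => i _; rewrite nth_bits.
Qed.

Lemma seq_exchange_bits (k : 'I_4) a b :
  seq_exchange k (bits a) (bits b) = exchange lo6 hi6 k a b.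
Proof.
apply/(forall_ordP 6 (fun i => _ == _))/forallP => ab i.
  by have := ab i; rewrite !nth_bits !ffunE.
by have := ab i; rewrite !nth_bits !ffunE.
Qed.

Lemma weight_ties a b : weight wt6 a = weight wt6 b -> a != b ->
  exists k, exchange lo6 hi6 k a b || exchange lo6 hi6 k b a.
Proof.
move=> wab ab; have := all_bitsP (all_bitsP seq_ties (size_bits a)) (size_bits b).
rewrite !seq_weight_bits wab eqxx implyTb.
have -> : bits a != bits b.
  by apply: contraNneq ab => ab; apply/eqP/ffunP => i; rewrite -!nth_bits ab.
by rewrite implyTb => /exists_ordP[k kab]; exists k; rewrite -!seq_exchange_bits.
Qed.

(** * The noncoherent initial ideal *)

Theorem mainTheorem2 (R : realType) (F : closedFieldType) (charF : 2%N \notin [pchar F]) :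
  exists (lt : rel (mono 6)) (I : set (ext F 6)),
    [/\ term_order lt, ~ coherent R lt,
        two_sided_ideal I /\ homogeneous I &
        noncoherent_initial_ideal R lt I].
Proof.
set lt := exchange_lt wt6 lo6 hi6.
have lt_term : term_order lt.
  apply: exchange_lt_term_order; [|exact: weight_lo6|exact: pair_clash
    |exact: weight_ties].
  by case=> [[|[|[|[|[|[|]]]]]] lti].
have lohi k : lt (lo6 k) (hi6 k).
  apply/orP; right; apply/existsP; exists k; apply/forallP => i; exact/eqP/addnC.
exists lt, (exchange_ideal 3 lo6 hi6); split=> //.
- exact: balanced_not_coherent pair_balanced lohi.
- split; first exact: exchange_ideal_two_sided mdeg_lo6 mdeg_hi6.
  exact: exchange_ideal_homogeneous mdeg_lo6 mdeg_hi6.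
- move=> ltc ltc_term ltc_coh same.
  apply: (balanced_not_coherent pair_balanced _ ltc_coh).
  exact: (same_initial_ideal_exchange mdeg_lo6 mdeg_hi6 lo6_inj hi6_inj lo6_neq_hi6
    lt_term lohi ltc_term same).
Qed.
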